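(* Let $E$ be a CM field of degree $2g$ over $\mathbb{Q}$ with maximal totally real subfield $F$, and let $\Sigma$ be a CM type on $E$. Write $\mathrm{Gal}(E^c/F^c)\cong(\mathbb{Z}/2\mathbb{Z})^v$. If $v=g$, then $L_\mu=X_*(GU_E)$ and the reciprocity morphism $r:R_{E'}\to R_E$ has connected kernel.
   Context: $E^c,F^c\subset\overline{\mathbb{Q}}\subset\mathbb{C}$ are the Galois closures of $E,F$ over $\mathbb{Q}$, $\rho$ is complex conjugation. Put $\mathfrak{g}=\mathrm{Gal}(E^c/\mathbb{Q})$, acting on the right on $E^c$ (so $\alpha\beta$ means $\alpha$ followed by $\beta$), and $\mathfrak{h}=\mathrm{Gal}(E^c/E)$. Then $J=\mathrm{Hom}(E,\overline{\mathbb{Q}})=\mathfrak{h}\backslash\mathfrak{g}$ with right $\mathfrak{g}$-action. $\mathrm{Gal}(E^c/F^c)$ is always an elementary abelian $2$-group. A CM type is a subset $\Sigma\subset J$ with $J=\Sigma\sqcup\Sigma\rho$; write $\Sigma=\{[\alpha_1],\dots,[\alpha_g]\}$ with $[\alpha_i]=\mathfrak{h}\alpha_i$, and $[\alpha_{-i}]=\mathfrak{h}\alpha_i\rho$. For a number field $M$, $R_M=\mathrm{Res}_{M/\mathbb{Q}}\mathbb{G}_{m,M}$; $X_*$ denotes the cocharacter lattice. $X_*(R_E)=\bigoplus_{i=1}^g(\mathbb{Z}[\alpha_i]\oplus\mathbb{Z}[\alpha_{-i}])$. $U_E=\{x\in R_E: xx^\rho=1\}$ and $GU_E$ is the subtorus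 of $R_E$ generated by $U_E$ and $\mathbb{G}_{m,\mathbb{Q}}\subset R_E$, so that $$X_*(GU_E)=\Bigl\{\sum_{i=1}^g(n_i[\alpha_i]+n_{-i}[\alpha_{-i}]) : n_i+n_{-i}=n_j+n_{-j}\ \text{for all } i,j\Bigr\}.$$ Put $\mu=\sum_{i=1}^g[\alpha_i]$. Let $\tilde\Sigma=\{\alpha\in\mathfrak{g}:\mathfrak{h}\alpha\in\Sigma\}$, $\mathfrak{h}'=\{\alpha\in\mathfrak{g}:\tilde\Sigma\alpha=\tilde\Sigma\}$, and let $E'\subset E^c$ be the fixed field of $\mathfrak{h}'$ (the reflex field of $(E,\Sigma)$). The reciprocity morphism $r:R_{E'}\to R_E$ is the morphism of $\mathbb{Q}$-tori (factoring through $GU_E$) given on cocharacters by $$X_*(r):X_*(R_{E'})=\bigoplus_{\mathfrak{h}'\beta\in\mathfrak{h}'\backslash\mathfrak{g}}\mathbb{Z}\,\mathfrak{h}'\beta\to X_*(R_E),\qquad \mathfrak{h}'\beta\mapsto\sum_{i=1}^g\mathfrak{h}\alpha_i\beta .$$ Finally $L_\mu$ is the image of $X_*(r)$, a submodule of $X_*(GU_E)$. *)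

(* Defs.v *)
From HB Require Import structures.
From mathcomp Require Import all_boot all_order all_fingroup all_algebra.
From mathcomp Require Import all_solvable all_field mpoly.

Set Implicit Arguments.
Unset Strict Implicit.
Unset Printing Implicit Defensive.

Import GroupScope Order.TTheory GRing.Theory Num.Theory.
Local Open Scope ring_scope.

(* Throughout, L is a number field that is normal over rat, embedded in algC    *)
(* (playing the role of Qbar inside C) by iota; all other number fields are     *)
(* subfields of L. In mathcomp, (a * b)%g is "a followed by b" on 'Gal(_ / _),  *)
(* so cosets H :* a carry the right Galois action used here.                    *)

Section NumberFields.

Variable L : splittingFieldType rat.
Implicit Types K E F Ec : {subfield L}.

Definition totally_real K : Prop :=
  forall (phi : {rmorphism subvs_of K -> algC}) (x : subvs_of K),
    phi x \is Num.real.

Definition totally_imaginary K : Prop :=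
  forall phi : {rmorphism subvs_of K -> algC},
    exists x : subvs_of K, phi x \isn't Num.real.

Definition CM_field E : Prop :=
  totally_imaginary E /\
  exists F : {subfield L},
    [/\ (F <= E)%VS, \dim_F E = 2%N & totally_real F].

Definition max_totally_real_subfield E F : Prop :=
  [/\ (F <= E)%VS, totally_real F
    & forall K, (K <= E)%VS -> totally_real K -> (K <= F)%VS].

Definition galois_closure E Ec : Prop :=
  [/\ (E <= Ec)%VS, galois 1 Ec
    & forall K, (E <= K)%VS -> galois 1 K -> (Ec <= K)%VS].

Definition complex_conjugation (iota : {rmorphism L -> algC}) Ec
    (rho : gal_of Ec) : Prop :=
  rho \in 'Gal(Ec / 1) /\
  forall x : L, x \in Ec -> iota (rho x) = (iota x)^*.

End NumberFields.

(* A split torus over algC with cocharacter lattice Z^I, I finite, is given by  *)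
(* its group of algC-points, namely (algC minus 0)^I inside affine space.       *)

Section Tori.

Definition torus (I : finType) (z : {ffun I -> algC}) : Prop :=
  forall i, z i != 0.

(* The one-parameter subgroup t |-> t^x attached to the cocharacter x. *)
Definition cochar_eval (I : finType) (x : {ffun I -> int}) (t : algC) :
    {ffun I -> algC} :=
  [ffun i => t ^ x i].

Definition cochar_basis (I : finType) (i : I) : {ffun I -> int} :=
  [ffun k => (k == i)%:R].

(* The morphism of tori inducing the homomorphism f on cocharacters, i.e.       *)
(* the tensor product of f with the multiplicative group of algC.               *)
Definition torus_map (I J : finType) (f : {ffun I -> int} -> {ffun J -> int})
    (z : {ffun I -> algC}) : {ffun J -> algC} :=
  [ffun j => \prod_(i : I) z i ^ f (cochar_basis i) j].

Lemma torus_map_cochar (I J : finType)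
    (f : {additive {ffun I -> int} -> {ffun J -> int}}) x (t : algC) :
  t != 0 -> torus_map f (cochar_eval x t) = cochar_eval (f x) t.
Proof.
move=> t0; apply/ffunP => j; rewrite !ffunE.
have xE : x = \sum_i cochar_basis i *~ x i.
  apply/ffunP => k; rewrite sum_ffunE (bigD1 k) //= big1 => [|i ik].
    by rewrite addr0 ffunMzE ffunE eqxx -mulrzl mulr1 intz.
  by rewrite ffunMzE ffunE eq_sym (negPf ik) mul0rz.
rewrite [in RHS]xE raddf_sum sum_ffunE.
rewrite (big_morph (fun n : int => t ^ n) (fun a b => expfzDr a b t0) (expr0z t)).
apply: eq_bigr => i _.
by rewrite ffunE raddfMz ffunMzE -mulrzl intz exprz_exp.
Qed.

Definition torus_kernel (I J : finType)
    (f : {ffun I -> int} -> {ffun J -> int}) (z : {ffun I -> algC}) : Prop :=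
  torus z /\ torus_map f z = [ffun => 1].

Definition zariski_closed (I : finType) (C : {ffun I -> algC} -> Prop) : Prop :=
  exists S : {mpoly algC[#|I|]} -> Prop,
    forall z, C z <-> forall p, S p -> p.@[fun k => z (enum_val k)] = 0.

(* Connectedness of X for the topology induced by the Zariski topology of       *)
(* affine space. *)
Definition zariski_connected (I : finType) (X : {ffun I -> algC} -> Prop) :
    Prop :=
  (exists z, X z) /\
  forall C D : {ffun I -> algC} -> Prop,
    zariski_closed C -> zariski_closed D ->
    (forall z, X z -> C z \/ D z) ->
    (exists z, X z /\ C z) -> (exists z, X z /\ D z) ->
    exists z, [/\ X z, C z & D z].

End Tori.

Section Reciprocity.

Variables (L : splittingFieldType rat) (Ec : {subfield L}).
Implicit Types (M E : {subfield L}) (rho : gal_of Ec).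
Implicit Type (Sigma : {set {set gal_of Ec}}).

(* Hom(M, Qbar) for M <= Ec, as a set of cosets and as a finite type. *)
Definition embeddings M : {set {set gal_of Ec}} :=
  rcosets 'Gal(Ec / M) 'Gal(Ec / 1).

Definition emb M : finType := {A : {set gal_of Ec} | A \in embeddings M}.

(* The cocharacter lattice of R_M = Res_(M/Q) G_m; correspondingly the points   *)
(* of R_M over algC are the z : {ffun emb M -> algC} with torus z.              *)
Definition cochar M : Type := {ffun emb M -> int}.

Definition cochar_coset M (A : {set gal_of Ec}) : cochar M :=
  [ffun B : emb M => (val B == A)%:R].

Definition CM_type E rho Sigma : Prop :=
  Sigma :|: [set A :* rho | A in Sigma] = embeddings E /\
  [disjoint Sigma & [set A :* rho | A in Sigma]].

(* The coordinate of z^rho at the embedding A is the coordinate of z at A :* rho. *)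
Definition U_points E rho (z : {ffun emb E -> algC}) : Prop :=
  torus z /\
  forall A B : emb E, val B = val A :* rho -> z A * z B = 1.

(* The subtorus generated by U_E and the diagonal G_m. *)
Definition GU_points E rho (z : {ffun emb E -> algC}) : Prop :=
  exists (u : {ffun emb E -> algC}) (c : algC),
    [/\ U_points rho u, c != 0 & forall A, z A = u A * c].

(* The cocharacters of R_E that factor through GU_E. *)
Definition cochar_GU E rho (x : cochar E) : Prop :=
  forall t : algC, t != 0 -> GU_points rho (cochar_eval x t).

Lemma complex_conjugationK (iota : {rmorphism L -> algC}) rho :
  complex_conjugation iota rho -> (rho * rho = 1)%g.
Proof.
move=> [rhoG rhoE]; apply/eqP/gal_eqP => x xE.
have rxE : rho x \in Ec by apply: memv_gal.
rewrite galM // gal_id; apply: (fmorph_inj iota).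
by rewrite !rhoE // conjCK.
Qed.

(* cochar_GU is the sublattice n_i + n_(-i) = n_j + n_(-j) of Z[Hom(E, Qbar)].  *)
Lemma cochar_GUP (iota : {rmorphism L -> algC}) E rho Sigma (x : cochar E) :
  complex_conjugation iota rho -> CM_type E rho Sigma ->
  cochar_GU rho x <->
  (forall A A' B B' : emb E, val A \in Sigma -> val B \in Sigma ->
     val A' = val A :* rho -> val B' = val B :* rho ->
     x A + x A' = x B + x B').
Proof.
move=> /complex_conjugationK rhoK [SigmaE _]; split=> [xGU A A' B B' _ _ AA BB|xE].
  have two0 : (2 : algC) != 0 by rewrite pnatr_eq0.
  have [u [c [[_ uU] c0 zE]]] := xGU 2 two0.
  apply: (@ieexprIz rat 2) => //; apply: (fmorph_inj (ratr : rat -> algC)).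
  rewrite !fmorphXz /= rmorph_nat.
  have zz C C' : val C' = val C :* rho -> (2 : algC) ^ (x C + x C') = c * c.
    move=> CC; rewrite expfzDr //.
    have := zE C; have := zE C'; rewrite !ffunE => -> ->.
    by rewrite mulrACA (uU C C' CC) mul1r.
  by rewrite (zz A A') // (zz B B').
move=> t t0.
have embS A : A \in Sigma -> A \in embeddings E.
  by rewrite -SigmaE inE => ->.
have embR A : A \in Sigma -> A :* rho \in embeddings E.
  by move=> AS; rewrite -SigmaE; apply/setUP; right; apply: imset_f.
have embP (A : emb E) : val A \in Sigma :|: [set A :* rho | A in Sigma].
  by rewrite SigmaE; apply: valP.
case: (set_0Vmem Sigma) => [S0|[A0 A0S]].
  have emb0 (A : emb E) : False.
    by have := embP A; rewrite S0 imset0 setU0 inE.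
  exists [ffun=> 1], 1; split; [|exact: oner_neq0|by move=> A; case: (emb0 A)].
  by split=> A; case: (emb0 A).
pose a : emb E := Sub A0 (embS _ A0S).
pose a' : emb E := Sub (A0 :* rho) (embR _ A0S).
pose c := sqrtC (t ^ (x a + x a')).
have cc : c * c = t ^ (x a + x a') by rewrite -expr2 sqrtCK.
have c0 : c != 0 by rewrite sqrtC_eq0 expfz_neq0.
exists [ffun A => t ^ x A / c], c; split=> //; last first.
  by move=> A; rewrite !ffunE divfK.
have key (A B : emb E) : val A \in Sigma -> val B = val A :* rho ->
    t ^ x A / c * (t ^ x B / c) = 1.
  move=> AS BA; rewrite mulrACA -expfzDr // (xE A B a a') //.
  by rewrite -invfM cc divff // expfz_neq0.
split=> [A|A B BA]; rewrite !ffunE.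
  by rewrite mulf_neq0 ?invr_eq0 // expfz_neq0.
have /setUP[AS|/imsetP[C CS AC]] := embP A.
  exact: key.
rewrite mulrC; apply: key.
  by rewrite BA AC -rcosetM rhoK mulg1.
by rewrite BA -rcosetM rhoK mulg1.
Qed.

Definition lift_type E Sigma : {set gal_of Ec} :=
  [set a in 'Gal(Ec / 1) | 'Gal(Ec / E) :* a \in Sigma].

Definition reflex_group E Sigma : {set gal_of Ec} :=
  [set a in 'Gal(Ec / 1) | lift_type E Sigma :* a == lift_type E Sigma].

Definition reflex_field E Sigma : {subfield L} :=
  [aspace of fixedField (reflex_group E Sigma)].

(* X_*(r). The sum over A in Sigma of [A b] does not depend on the element b of *)
(* the coset B (cochar_r_basis below), so the choice of repr is harmless.       *)
Definition cochar_r E Sigma (y : cochar (reflex_field E Sigma)) : cochar E :=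
  \sum_(B : emb (reflex_field E Sigma))
    (\sum_(A in Sigma) cochar_coset E (A :* repr (val B))) *~ y B.

Lemma gal_reflex_field E Sigma :
  'Gal(Ec / reflex_field E Sigma) = reflex_group E Sigma.
Proof.
have hG : group_set (reflex_group E Sigma).
  apply/group_setP; split; first by rewrite inE group1 /= mulg1.
  move=> a b; rewrite !inE => /andP[aG /eqP aS] /andP[bG /eqP bS].
  by rewrite groupM //= rcosetM aS bS.
exact: (gal_fixedField (Group hG)).
Qed.

Lemma cochar_r_basis E Sigma (B : emb (reflex_field E Sigma)) b :
  Sigma \subset embeddings E -> b \in val B ->
  cochar_r (cochar_basis B) = \sum_(A in Sigma) cochar_coset E (A :* b).
Proof.
move=> /subsetP SE bB.
have basisE (C : emb (reflex_field E Sigma)) :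
  cochar_basis B C = (C == B)%:R by rewrite ffunE.
have -> : cochar_r (cochar_basis B) =
    \sum_(A in Sigma) cochar_coset E (A :* repr (val B)).
  rewrite /cochar_r (bigD1 B) //= [X in _ + X]big1 => [|C CB].
    by rewrite basisE eqxx addr0 mulr1z.
  by rewrite basisE (negPf CB) mulr0z.
have /rcosetsP[c cG Bc] := valP B.
have rB : repr (val B) \in val B by apply: mem_repr bB.
pose h := (b * (repr (val B))^-1)%g.
have hh : h \in reflex_group E Sigma.
  rewrite -gal_reflex_field /h; move: bB rB; rewrite Bc !mem_rcoset => x y.
  by have := groupM x (groupVr y); rewrite invMg invgK mulgA mulgKV.
have -> : b = (h * repr (val B))%g by rewrite /h mulgKV.
have hS A : A \in Sigma -> A :* h \in Sigma.
  move=> AS; have /rcosetsP[a aG Aa] := SE _ AS.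
  move: hh; rewrite inE => /andP[_ /eqP hS].
  have : (a * h)%g \in lift_type E Sigma.
    by rewrite -hS mem_rcoset mulgK inE aG -Aa.
  by rewrite inE => /andP[_]; rewrite rcosetM -Aa.
have hI : injective (fun A : {set gal_of Ec} => A :* h).
  exact: (can_inj (rcosetK h)).
have SI : [set A :* h | A in Sigma] = Sigma.
  apply/eqP; rewrite eqEcard card_imset // leqnn andbT.
  by apply/subsetP => _ /imsetP[A AS ->]; apply: hS.
move: (repr (val B)) => b0.
rewrite -[in LHS]SI big_imset /=; last by move=> ? ? _ _; apply: hI.
by apply: eq_bigr => A _; rewrite [A :* (_ * b0)]rcosetM.
Qed.

Definition L_mu E Sigma (x : cochar E) : Prop :=
  exists y : cochar (reflex_field E Sigma), cochar_r y = x.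

End Reciprocity.

(* Main.v *)
Require Import Defs.
From HB Require Import structures.
From mathcomp Require Import all_boot all_order all_fingroup all_algebra.
From mathcomp Require Import all_solvable all_field mpoly.
From Stdlib Require Import Classical_Prop.

Set Implicit Arguments.
Unset Strict Implicit.
Unset Printing Implicit Defensive.

Import GroupScope Order.TTheory GRing.Theory Num.Theory.
Local Open Scope ring_scope.

(** Write G, K and H for the Galois groups of Ec over the rationals, over F and
over E, and N for that of Ec over Fc. Every conjugate of rho lies in K, because
F is totally real, and outside H, because E is totally imaginary. As H has index
2 in K and contains no nontrivial normal subgroup of G, this makes rho central
in G ([rho_central]). Hence right multiplication by an element n of N, which is
a normal subgroup of G inside K, either fixes a coset A of H or sends it to
A rho ([rcoset_sign]). An element of N is determined by the set of the A in
Sigma that it moves; there are 2 ^ g such sets and, since v = g, as many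
elements in N, so every set occurs. In particular each A in Sigma is moved by
some n_A in N that fixes all the other members of Sigma ([single_flip]).

The class of n_A is sent by X_*(r) to mu - [A] + [A rho], and that of 1 to mu.
A cocharacter x of GU_E, with x_A + x_(A rho) = c for all A, is
c mu + sum_(A in Sigma) x_(A rho) ([A rho] - [A]), so it is the image of
c [1] + sum_(A in Sigma) x_(A rho) ([n_A] - [1]) ([cochar_sectionK]). Conversely
every image lies in X_*(GU_E), because exactly one of A and A rho lies in the
CM type Sigma b, for every b in G ([L_mu_sub_GU]). This gives the equality of
lattices.

The preimage just written is linear in x, and with c read off at one fixed
embedding it makes sense for every cocharacter x of R_E. So there is an additive
map s with f s f = f for f = X_*(r), which expresses that the image of f has
a complement. Then the kernel of r is the image of the torus R_E' under the
endomorphism with cocharacter map y - s (f y) ([torus_kernel_connected]), and the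
image of a torus under a monomial map is connected: restricted to the line
joining two points of the torus, a polynomial function becomes a rational
function of one variable, so if two closed sets cover the image, one of them
contains the image of that line and both points ([torus_image_connected]). *)

(** * Connectedness of images and kernels of torus morphisms *)

Section LaurentFunctions.

Variable d : {poly algC}.

(** The functions that belong to the localization of the polynomial ring at d,
described by their values, so that no fraction field is involved. *)
Definition regular_off (h : algC -> algC) : Prop :=
  exists (a : {poly algC}) (k : nat),
    forall u, d.[u] != 0 -> h u = a.[u] / d.[u] ^+ k.

Lemma regular_off_const c : regular_off (fun=> c).
Proof. by exists c%:P, 0%N => u _; rewrite hornerC expr0 divr1. Qed.

Lemma regular_offD h1 h2 : regular_off h1 -> regular_off h2 ->
  regular_off (fun u => h1 u + h2 u).
Proof.
move=> [a [k ha]] [b [l hb]]; exists (a * d ^+ l + b * d ^+ k), (k + l)%N => u du.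
by rewrite ha // hb // !hornerE exprD addf_div ?expf_neq0.
Qed.

Lemma regular_offM h1 h2 : regular_off h1 -> regular_off h2 ->
  regular_off (fun u => h1 u * h2 u).
Proof.
move=> [a [k ha]] [b [l hb]]; exists (a * b), (k + l)%N => u du.
by rewrite ha // hb // hornerM exprD mulf_div.
Qed.

Lemma regular_offX h n : regular_off h -> regular_off (fun u => h u ^+ n).
Proof.
move=> hh; elim: n => [|n [a [k IHn]]]; first exact: regular_off_const.
have [b [l hb]] := regular_offM hh (ex_intro _ a (ex_intro _ k IHn)).
by exists b, l => u du; rewrite exprS hb.
Qed.

Lemma regular_off_sum (I : Type) (r : seq I) (h : I -> algC -> algC) :
  (forall i, regular_off (h i)) -> regular_off (fun u => \sum_(i <- r) h i u).
Proof.
move=> hh; elim: r => [|i r [a [k IHr]]].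
  by exists 0, 0%N => u _; rewrite big_nil horner0 mul0r.
have [b [l hb]] := regular_offD (hh i) (ex_intro _ a (ex_intro _ k IHr)).
by exists b, l => u du; rewrite big_cons hb.
Qed.

Lemma regular_off_prod (I : Type) (r : seq I) (h : I -> algC -> algC) :
  (forall i, regular_off (h i)) -> regular_off (fun u => \prod_(i <- r) h i u).
Proof.
move=> hh; elim: r => [|i r [a [k IHr]]].
  by exists 1, 0%N => u _; rewrite big_nil hornerC expr0 divr1.
have [b [l hb]] := regular_offM (hh i) (ex_intro _ a (ex_intro _ k IHr)).
by exists b, l => u du; rewrite big_cons hb.
Qed.

Lemma regular_off_expz (a : {poly algC}) (n : int) :
  a %| d -> regular_off (fun u => a.[u] ^ n).
Proof.
have reg_horner b : regular_off (horner b).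
  by exists b, 0%N => u _; rewrite expr0 divr1.
move=> /dvdpP[b db]; case: n => n; first exact: regular_offX.
suff /(regular_offX n.+1) [e [k he]] : regular_off (fun u => a.[u]^-1).
  by exists e, k => u du; rewrite NegzE -exprnN -exprVn he.
exists b, 1%N => u; rewrite db hornerM expr1 mulf_eq0 => /norP[b0 _].
by rewrite invfM mulrA divff // mul1r.
Qed.

Lemma regular_off_meval n (z : algC -> 'I_n -> algC) (p : {mpoly algC[n]}) :
  (forall i, regular_off (fun u => z u i)) -> regular_off (fun u => p.@[z u]).
Proof.
move=> hz.
suff [a [k ha]] : regular_off
    (fun u => \sum_(m <- msupp p) p@_m * \prod_(i < n) z u i ^+ m i).
  by exists a, k => u du; rewrite mevalE ha.
apply: regular_off_sum => m; apply: regular_offM; first exact: regular_off_const.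
by apply: regular_off_prod => i; apply: regular_offX.
Qed.

End LaurentFunctions.

Section TorusMaps.

Implicit Types I J K : finType.

(** The product p d vanishes everywhere, in particular at more natural numbers
than its degree allows if it is nonzero. *)
Lemma poly0_cofinite (d p : {poly algC}) :
  d != 0 -> (forall u, d.[u] != 0 -> p.[u] = 0) -> p = 0.
Proof.
move=> d0 dp; apply/eqP; apply: contraT => p0.
have pd0 : p * d != 0 by rewrite mulf_neq0.
suff /(max_poly_roots pd0) /(_ (_ : uniq [seq i%:R | i <- iota 0 (size (p * d))])) :
    all (root (p * d)) [seq i%:R | i <- iota 0 (size (p * d))].
  rewrite map_inj_uniq ?iota_uniq ?size_map ?size_iota ?ltnn; last first.
    by move=> i j /eqP; rewrite eqr_nat => /eqP.
  by move=> /(_ isT).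
apply/allP => u _; rewrite rootE hornerM mulf_eq0.
by have [|/dp->] := eqVneq d.[u] 0; rewrite ?eqxx ?orbT.
Qed.

(** The affine line from s to t. It leaves the torus exactly at the roots of
[torus_line_den s t]. *)
Definition torus_line I (s t : {ffun I -> algC}) (u : algC) : {ffun I -> algC} :=
  [ffun i => s i + u * (t i - s i)].

Definition torus_line_den I (s t : {ffun I -> algC}) : {poly algC} :=
  \prod_i ((s i)%:P + 'X * (t i - s i)%:P).

Lemma torus_line0 I (s t : {ffun I -> algC}) : torus_line s t 0 = s.
Proof. by apply/ffunP => i; rewrite ffunE mul0r addr0. Qed.

Lemma torus_line1 I (s t : {ffun I -> algC}) : torus_line s t 1 = t.
Proof. by apply/ffunP => i; rewrite ffunE mul1r addrC subrK. Qed.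

Lemma torus_lineP I (s t : {ffun I -> algC}) u :
  torus (torus_line s t u) <-> (torus_line_den s t).[u] != 0.
Proof.
rewrite /torus_line_den horner_prod; split=> [Tu|/prodf_neq0 du i].
  by apply/prodf_neq0 => i _; have := Tu i; rewrite ffunE !hornerE.
by have := du i isT; rewrite ffunE !hornerE.
Qed.

Lemma regular_torus_map I J (f : {ffun I -> int} -> {ffun J -> int})
    (s t : {ffun I -> algC}) (p : {mpoly algC[#|J|]}) :
  regular_off (torus_line_den s t)
    (fun u => p.@[fun k => torus_map f (torus_line s t u) (enum_val k)]).
Proof.
apply: regular_off_meval => k.
suff [a [e ha]] : regular_off (torus_line_den s t) (fun u => \prod_(i : I)
    ((s i)%:P + 'X * (t i - s i)%:P).[u] ^ f (cochar_basis i) (enum_val k)).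
  exists a, e => u du; rewrite -ha // ffunE; apply: eq_bigr => i _.
  by rewrite ffunE !hornerE.
apply: regular_off_prod => i; apply: regular_off_expz.
by rewrite /torus_line_den (bigD1 i) //= dvdp_mulr.
Qed.

(** The image is even irreducible. If p vanishes on C and q on D, then p q
vanishes on the image of the part of a line that lies in the torus; in the
parameter of that line, p or q must then vanish identically. So one of C and D
contains the image of all that part, hence both prescribed points. *)
Lemma torus_image_connected I J (f : {ffun I -> int} -> {ffun J -> int})
    (X : {ffun J -> algC} -> Prop) :
  (forall z, X z <-> exists2 t, torus t & z = torus_map f t) ->
  zariski_connected X.
Proof.
move=> XE; split.
  exists (torus_map f [ffun => 1]); apply/XE; exists [ffun => 1] => // i.
  by rewrite ffunE oner_neq0.
move=> C D [SC CE] [SD DE] XCD [z1 [X1 C1]] [z2 [X2 D2]].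
have /XE[s Ts zs] := X1; have /XE[t Tt zt] := X2.
pose d := torus_line_den s t.
have d0 : d.[0] != 0 by apply/torus_lineP; rewrite torus_line0.
have d1 : d.[1] != 0 by apply/torus_lineP; rewrite torus_line1.
have dn0 : d != 0 by apply: contraNneq d0 => ->; rewrite horner0.
pose w u := torus_map f (torus_line s t u).
have wX u : d.[u] != 0 -> X (w u).
  by move=> /torus_lineP Tu; apply/XE; exists (torus_line s t u).
have w0 : w 0 = z1 by rewrite /w torus_line0.
have w1 : w 1 = z2 by rewrite /w torus_line1.
pose vanish (p : {mpoly algC[#|J|]}) :=
  forall u, d.[u] != 0 -> p.@[fun k => w u (enum_val k)] = 0.
have alt p q : SC p -> SD q -> vanish p \/ vanish q.
  move=> Sp Sq.
  have [a [k ha]] := regular_torus_map f s t p.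
  have [b [l hb]] := regular_torus_map f s t q.
  have ab0 : a * b = 0.
    apply: (poly0_cofinite dn0) => u du; rewrite hornerM.
    have quot0 (c : {poly algC}) m : c.[u] / d.[u] ^+ m = 0 -> c.[u] = 0.
      by move/eqP; rewrite mulf_eq0 invr_eq0 expf_eq0 (negPf du) andbF orbF => /eqP.
    case: (XCD _ (wX u du)) => [/CE/(_ p Sp)|/DE/(_ q Sq)].
      by rewrite ha // => /quot0->; rewrite mul0r.
    by rewrite hb // => /quot0->; rewrite mulr0.
  move/eqP: ab0; rewrite mulf_eq0 => /orP[]/eqP c0; [left|right] => u du.
    by rewrite ha // c0 horner0 mul0r.
  by rewrite hb // c0 horner0 mul0r.
(* If the equations of C hold along the line then z2 is in C; otherwise those of
D hold along it, and z1 is in D. *)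
have [SCw|nSCw] := classic (forall p, SC p -> vanish p).
  exists z2; split=> //; apply/CE => p Sp.
  by have := SCw p Sp 1 d1; rewrite w1.
exists z1; split=> //; apply/DE => q Sq; rewrite -w0.
have [/(_ 0 d0) //|nq] := classic (vanish q).
by case: nSCw => p Sp; case: (alt p q Sp Sq).
Qed.

Lemma torus_torus_map I J (f : {ffun I -> int} -> {ffun J -> int}) z :
  torus z -> torus (torus_map f z).
Proof.
by move=> Tz j; rewrite ffunE; apply/prodf_neq0 => i _; apply: expfz_neq0.
Qed.

Lemma ffun_basisE I (x : {ffun I -> int}) : x = \sum_i cochar_basis i *~ x i.
Proof.
apply/ffunP => k; rewrite sum_ffunE (bigD1 k) //= big1 => [|i ik].
  by rewrite addr0 ffunMzE ffunE eqxx intz.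
by rewrite ffunMzE ffunE eq_sym (negPf ik) mul0rz.
Qed.

Lemma expfz_sum (t : algC) (I : Type) (r : seq I) (n : I -> int) :
  t != 0 -> t ^ (\sum_(i <- r) n i) = \prod_(i <- r) t ^ n i.
Proof.
by move=> t0; apply: (big_morph (fun n => t ^ n) (fun a b => expfzDr a b t0)).
Qed.

Lemma prodf_expz I (z : I -> algC) (n : int) :
  (\prod_i z i) ^ n = \prod_i z i ^ n.
Proof.
by apply: (big_morph (fun t => t ^ n) (fun a b => expfzMl a b n)); apply: exp1rz.
Qed.

Lemma torus_map_comp I J K (f : {ffun I -> int} -> {ffun J -> int})
    (h : {additive {ffun J -> int} -> {ffun K -> int}}) z :
  torus z -> torus_map h (torus_map f z) = torus_map (h \o f) z.
Proof.
move=> Tz; apply/ffunP => k; rewrite !ffunE.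
under eq_bigr => j _ do rewrite ffunE prodf_expz.
rewrite exchange_big /=; apply: eq_bigr => i _.
rewrite [in RHS](ffun_basisE (f _)) raddf_sum sum_ffunE expfz_sum //.
by apply: eq_bigr => j _; rewrite raddfMz ffunMzE exprz_exp -mulrzl intz.
Qed.

Lemma torus_map_id I (z : {ffun I -> algC}) : torus_map id z = z.
Proof.
apply/ffunP => i; rewrite ffunE (bigD1 i) //= big1 => [|j ji].
  by rewrite mulr1 ffunE eqxx.
by rewrite ffunE eq_sym (negPf ji).
Qed.

Lemma torus_mapB I J (f h : {ffun I -> int} -> {ffun J -> int}) z j :
  torus z ->
  torus_map (fun x => f x - h x) z j = torus_map f z j / torus_map h z j.
Proof.
move=> Tz; rewrite !ffunE -prodf_div; apply: eq_bigr => i _.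
by rewrite !ffunE expfzDr // invr_expz.
Qed.

(** With P = id - s f, the relation f s f = f makes the kernel of the torus
morphism of f equal to the image of that of P: f P = 0, and the morphism of s f
is trivial on the kernel of that of f. *)
Lemma torus_kernel_connected I J
    (f : {additive {ffun I -> int} -> {ffun J -> int}})
    (s : {additive {ffun J -> int} -> {ffun I -> int}}) :
  (forall x, f (s (f x)) = f x) -> zariski_connected (torus_kernel f).
Proof.
move=> fsf; pose P x := x - s (f x).
apply: (@torus_image_connected _ _ P) => z.
split=> [[Tz fz]|[t Tt ->]].
  exists z => //; apply/ffunP => i.
  rewrite torus_mapB // torus_map_id -(torus_map_comp f s Tz) fz.
  rewrite ffunE big1 ?divr1 // => j _.
  by rewrite ffunE exp1rz.
split; first exact: torus_torus_map.
rewrite torus_map_comp //; apply/ffunP => j; rewrite !ffunE big1 // => i _.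
by rewrite /= /P raddfB fsf subrr ffunE expr0z.
Qed.

End TorusMaps.

(** * Sign changes on cosets *)

Section CosetGroupTheory.

Local Open Scope group_scope.

Variables (gT : finGroupType) (G K H : {group gT}) (rho : gT).
Hypotheses (sHK : H \subset K) (indexHK : #|K : H| = 2%N).

Lemma index2_rcoset x : x \in K :\: H -> K :\: H = H :* x.
Proof.
rewrite inE => /andP[xH xK]; apply/esym/eqP.
have card2 : (#|K| = #|H| + #|H|)%N.
  by rewrite -(Lagrange sHK) indexHK muln2 addnn.
rewrite eqEcard cardsD (setIidPr sHK) card_rcoset card2 addnK leqnn andbT.
apply/subsetP => _ /rcosetP[h hH ->].
by rewrite inE groupMl // xH groupM // (subsetP sHK).
Qed.

Hypotheses (rhoKH : forall a, a \in G -> rho ^ a \in K :\: H).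
Hypothesis coreH : gcore H G = 1.

Lemma mem_gcoreP x : reflect (forall b, b \in G -> x ^ b \in H) (x \in gcore H G).
Proof.
apply: (iffP bigcapP) => xH b bG; last by rewrite mem_conjg xH ?groupV.
by have := xH b^-1; rewrite groupV => /(_ bG); rewrite mem_conjg invgK.
Qed.

(** Any two conjugates of rho lie in the same nontrivial coset of H in K, so all
the conjugates of the quotient of rho ^ a by rho lie in H. *)
Lemma rho_central a : a \in G -> commute rho a.
Proof.
move=> aG; suff : rho ^ a * rho^-1 \in gcore H G.
  rewrite coreH inE => /eqP/(canRL (mulgKV _)); rewrite mul1g => /conjg_fixP.
  by move/commgP.
apply/mem_gcoreP => b bG; rewrite conjMg conjVg -conjgM -mem_rcoset.
by rewrite -(index2_rcoset (rhoKH bG)) rhoKH ?groupM.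
Qed.

Lemma rcoset_rhoC a : a \in G -> H :* (rho * a) = H :* a :* rho.
Proof. by move=> aG; rewrite -rcosetM (rho_central aG). Qed.

Variable N : {group gT}.
Hypotheses (sNG : N \subset G) (sNK : N \subset K) (nNG : G \subset 'N(N)).

(** For A = H a, moving n across a replaces it by a conjugate in N, which lies in
K, hence in H or in H rho. *)
Lemma rcoset_sign A n : A \in rcosets H G -> n \in N ->
  A :* n = A \/ A :* n = A :* rho.
Proof.
move=> /rcosetsP[a aG ->] nN.
have naN : n ^ a^-1 \in N by rewrite memJ_norm // (subsetP nNG) ?groupV.
have -> : H :* a :* n = H :* (n ^ a^-1) :* a.
  by rewrite -!rcosetM [in RHS]conjgE invgK !mulgA mulgKV.
have [nH|nH] := boolP (n ^ a^-1 \in H); first by left; rewrite rcoset_id.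
right; rewrite -rcoset_rhoC // [RHS]rcosetM; congr (_ * _).
have nKH : n ^ a^-1 \in K :\: H by rewrite inE nH (subsetP sNK).
by rewrite -(index2_rcoset nKH) (@index2_rcoset rho) // -[rho]conjg1 rhoKH.
Qed.

Variable Sigma : {set {set gT}}.
Hypothesis SigmaE : Sigma :|: [set A :* rho | A in Sigma] = rcosets H G.
Hypothesis cardN : #|N| = (2 ^ #|Sigma|)%N.

(** The elements of N are separated by the sets of cosets in Sigma that they move,
since an element fixing all cosets lies in the core of H. By the assumption on
the order of N every subset of Sigma is then such a set, in particular [set A]. *)
Lemma single_flip A : A \in Sigma ->
  exists n, [/\ n \in N, A :* n = A :* rho
              & forall B, B \in Sigma -> B != A -> B :* n = B].
Proof.
move=> AS.
have SG B : B \in Sigma -> B \in rcosets H G.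
  by rewrite -SigmaE inE => ->.
pose flips n := [set B in Sigma | B :* n != B].
have flips_inj : {in N &, injective flips}.
  move=> n m nN mN nm.
  have same B : B \in Sigma -> B :* n = B :* m.
    move=> BS; have /setP/(_ B) := nm; rewrite !inE BS /=.
    have [->|->] := rcoset_sign (SG _ BS) nN;
      have [->|->] := rcoset_sign (SG _ BS) mN => //; rewrite eqxx.
      by move/esym/negbFE/eqP.
    by move/negbFE/eqP.
  have : n * m^-1 \in gcore H G.
    rewrite -astabRs_rcosets; apply/astabP => B BG; rewrite /= rcosetE rcosetM.
    apply: (canLR (rcosetK m)).
    move: BG; rewrite -SigmaE => /setUP[BS|/imsetP[C CS ->]]; first exact: same.
    rewrite -!rcosetM !(rho_central (subsetP sNG _ _)) //.
    by rewrite !rcosetM same.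
  by rewrite coreH inE => /eqP/(canRL (mulgKV _)); rewrite mul1g.
have : flips @: N = powerset Sigma.
  apply/eqP; rewrite eqEcard card_in_imset // cardN card_powerset leqnn andbT.
  apply/subsetP => _ /imsetP[n _ ->]; rewrite inE.
  by apply/subsetP => B; rewrite inE => /andP[].
move/setP/(_ [set A]); rewrite [in RHS]inE sub1set AS => /imsetP[n nN An].
exists n; split=> // [|B BS BA].
  have [AnA|//] := rcoset_sign (SG _ AS) nN.
  by have := set11 A; rewrite An inE AnA eqxx andbF.
by have /setP/(_ B) := An; rewrite !inE BS (negPf BA) /= => /esym/negbFE/eqP.
Qed.

End CosetGroupTheory.

(** * Galois groups attached to a CM field *)

Section CMFields.

Variables (L : splittingFieldType rat) (iota : {rmorphism L -> algC}).
Implicit Types K E F Ec Fc : {subfield L}.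

Lemma totally_real_not_imaginary K : totally_real K -> ~ totally_imaginary K.
Proof.
move=> Kreal /(_ (iota \o vsval : {rmorphism subvs_of K -> algC})) [x].
by rewrite Kreal.
Qed.

(** F contains the totally real subfield F' provided by the CM structure, and is
not E because E is totally imaginary; the degree 2 leaves only F = F'. *)
Lemma CM_quadratic E F : CM_field E -> max_totally_real_subfield E F ->
  \dim_F E = 2%N.
Proof.
move=> [Eimag [F' [sF'E dimF' F'real]]] [sFE Freal Fmax].
have sF'F := Fmax _ sF'E F'real.
have dF'E := dim_sup_field sF'E; have dF'F := dim_sup_field sF'F.
have dFE := dim_sup_field sFE.
have F'gt0 : (0 < \dim F')%N := adim_gt0 F'.
have /eqP : (\dim_F E * \dim_F' F * \dim F' = 2 * \dim F')%N.
  by rewrite -mulnA -dF'F -dFE [LHS]dF'E dimF'.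
rewrite eqn_pmul2r // => /eqP dd.
have dFE1 : (\dim_F E != 1)%N.
  apply/eqP => d1; apply: (@totally_real_not_imaginary E) => //.
  suff -> : E = F by [].
  by apply/val_inj/esym/eqP; rewrite eqEdim sFE dFE d1 mul1n /=.
have : (\dim_F E %| 2)%N by apply/dvdnP; exists (\dim_F' F); rewrite mulnC dd.
by rewrite dvdn_divisors // !inE (negPf dFE1) => /eqP.
Qed.

Variables (Ec : {subfield L}) (rho : gal_of Ec).
Hypothesis hrho : complex_conjugation iota rho.

(** Conjugating rho by a amounts to testing reality in the embedding obtained
from iota by composition with the inverse of a. *)
Lemma fixed_conj_rho (a : gal_of Ec) x : x \in Ec ->
  ((rho ^ a)%g x == x) = (iota (a^-1%g x) \is Num.real).
Proof.
move=> xEc; have [_ rhoE] := hrho.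
have yEc : a^-1%g x \in Ec by apply: memv_gal.
have -> : (rho ^ a)%g x = a (rho (a^-1%g x)).
  by rewrite conjgE mulgA galM // galM.
have xE : a (a^-1%g x) = x by rewrite -galM // mulVg gal_id.
rewrite -[X in _ == X]xE (inj_eq (@fmorph_inj _ _ _)).
by rewrite -(inj_eq (fmorph_inj iota)) rhoE // CrealE.
Qed.

Lemma conj_rho_totally_real K (a : gal_of Ec) : (K <= Ec)%VS ->
  totally_real K -> (rho ^ a)%g \in 'Gal(Ec / K)%g.
Proof.
move=> sKEc Kreal; rewrite gal_kHom //; apply/kAHomP => x xK; apply/eqP.
rewrite fixed_conj_rho ?(subvP sKEc) //.
exact: (Kreal (iota \o a^-1%g \o vsval : {rmorphism _ -> _}) (Subvs xK)).
Qed.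

Lemma conj_rho_totally_imaginary K (a : gal_of Ec) : (K <= Ec)%VS ->
  totally_imaginary K -> (rho ^ a)%g \notin 'Gal(Ec / K)%g.
Proof.
move=> sKEc Kimag.
have [x] := Kimag (iota \o a^-1%g \o vsval : {rmorphism _ -> _}).
have xK := valP x; apply: contra => rK /=.
by rewrite -fixed_conj_rho ?(subvP sKEc) // (fixed_gal sKEc rK).
Qed.

Lemma index_gal K E : (K <= E <= Ec)%VS -> galois K Ec ->
  #|'Gal(Ec / K) : 'Gal(Ec / E)|%g = \dim_K E.
Proof.
move=> /andP[sKE sEEc] galK.
have galE : galois E Ec by apply: galoisS galK; rewrite sKE.
apply/eqP; rewrite -(eqn_pmul2l (cardG_gt0 'Gal(Ec / E))) Lagrange ?galS //.
rewrite -!galois_dim // -(eqn_pmul2r (adim_gt0 K)) -mulnA.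
by rewrite -!dim_sup_field // ?(subv_trans sKE).
Qed.

(** The fixed field of the core is Galois over the rationals and contains E, so it
contains Ec. *)
Lemma gcore_gal_closure E : galois_closure E Ec ->
  gcore 'Gal(Ec / E) 'Gal(Ec / 1) = 1%g.
Proof.
move=> [sEEc galEc Ecmin].
have nsC : gcore 'Gal(Ec / E) 'Gal(Ec / 1) <| 'Gal(Ec / 1).
  by apply: gcore_normal; rewrite galS ?sub1v.
pose C := [group of gcore 'Gal(Ec / E) 'Gal(Ec / 1)].
have galC : galois 1 (fixedField C) by apply: normal_fixedField_galois.
have sEC : (E <= fixedField C)%VS by rewrite -galois_connection // gcore_sub.
have sEcC := Ecmin [aspace of fixedField C] sEC galC.
apply/trivgP/subsetP => x xC; rewrite inE; apply/eqP/eqP/gal_eqP => y yEc.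
rewrite gal_id.
by have [_ ->] := mem_fixedFieldP (subvP sEcC y yEc).
Qed.

Lemma gal_closure_normal E F Fc : (F <= E)%VS -> galois_closure E Ec ->
  galois_closure F Fc ->
  'Gal(Ec / Fc) <| 'Gal(Ec / 1) /\ 'Gal(Ec / Fc) \subset 'Gal(Ec / F).
Proof.
move=> sFE [sEEc galEc _] [sFFc galFc Fcmin].
have sFcEc : (Fc <= Ec)%VS by apply: Fcmin => //; apply: subv_trans sEEc.
split; last exact: galS.
apply: normalField_normal; first by rewrite sub1v.
by case/and3P: galFc.
Qed.

End CMFields.

(** * The image of the reciprocity morphism on cocharacters *)

Section CocharMap.

Variables (L : splittingFieldType rat) (E Ec : {subfield L}).
Variable Sigma : {set {set gal_of Ec}}.

Lemma cochar_r_zmod_morphism : zmod_morphism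
  (@cochar_r L Ec E Sigma : {ffun _ -> int} -> {ffun emb Ec E -> int}).
Proof.
move=> x y; rewrite /cochar_r -sumrB; apply: eq_bigr => B _.
by rewrite -mulrzBr !ffunE.
Qed.

HB.instance Definition _ := GRing.isZmodMorphism.Build
  {ffun emb Ec (reflex_field E Sigma) -> int} {ffun emb Ec E -> int}
  (@cochar_r L Ec E Sigma) cochar_r_zmod_morphism.

End CocharMap.

Section Lattice.

Variables (L : splittingFieldType rat) (iota : {rmorphism L -> algC}).
Variables (E Ec : {subfield L}) (rho : gal_of Ec).
Variable Sigma : {set {set gal_of Ec}}.
Hypothesis hrho : complex_conjugation iota rho.
Hypothesis hSigma : CM_type E rho Sigma.
Hypothesis rhoC : forall a, a \in 'Gal(Ec / 1)%g -> commute rho a.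

Local Notation G := 'Gal(Ec / 1)%g.

Lemma embeddings_mulr (A : {set gal_of Ec}) a :
  A \in embeddings Ec E -> a \in G -> A :* a \in embeddings Ec E.
Proof.
move=> /rcosetsP[b bG ->] aG; apply/rcosetsP; exists (b * a)%g; first exact: groupM.
by rewrite rcosetM.
Qed.

Lemma repr_emb (M : {subfield L}) (B : emb Ec M) : repr (val B) \in G.
Proof.
case: B => B /= /rcosetsP[c cG ->].
have /rcosetP[h hH ->] := mem_repr_rcoset 'Gal(Ec / M) c.
by rewrite groupM // (subsetP (galS _ (sub1v _)) _ hH).
Qed.

Lemma CM_type_sub : Sigma \subset embeddings Ec E.
Proof. by case: hSigma => <- _; apply: subsetUl. Qed.

Lemma rcoset_rhoK (A : {set gal_of Ec}) : A :* rho :* rho = A.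
Proof. by rewrite -rcosetM (complex_conjugationK hrho) mulg1. Qed.

Lemma CM_type_rho (A : {set gal_of Ec}) : A \in embeddings Ec E ->
  (A :* rho \in Sigma) = (A \notin Sigma).
Proof.
have [SE /pred0P SD] := hSigma; rewrite -SE.
have excl B : B \in Sigma -> B :* rho \in Sigma -> false.
  move=> BS BrS; have := SD (B :* rho); rewrite /= BrS /=.
  by move/imset_f: BS => ->.
case/setUP=> [AS|/imsetP[B BS ->]].
  by rewrite AS; apply/negP => /(excl _ AS).
by rewrite rcoset_rhoK BS; apply/esym/negP => /(excl _ BS).
Qed.

(** The cocharacter mu of the CM type Sigma a, which is the image under X_*(r) of
the class of a. *)
Definition type_cochar (a : gal_of Ec) : cochar Ec E :=
  \sum_(A in Sigma) cochar_coset E (A :* a).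

Lemma type_cocharE a (C : emb Ec E) :
  type_cochar a C = (val C :* a^-1%g \in Sigma)%:R.
Proof.
have eqA A : (val C == A :* a) = (A == val C :* a^-1%g).
  by rewrite eq_sym; apply: (can2_eq (rcosetK a) (rcosetKV a)).
rewrite sum_ffunE; under eq_bigr => A _ do rewrite ffunE eqA.
have [CS|CS] := boolP (_ \in Sigma).
  by rewrite (bigD1 _ CS) /= eqxx big1 ?addr0 // => A /andP[_ /negPf->].
by rewrite big1 // => A AS; case: eqP => // eqAC; rewrite -eqAC AS in CS.
Qed.

Definition emb_bar (A : emb Ec E) : emb Ec E :=
  Sub (val A :* rho) (embeddings_mulr (valP A) (proj1 hrho)).

Lemma emb_barK : involutive emb_bar.
Proof. by move=> A; apply: val_inj; rewrite /= rcoset_rhoK. Qed.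

Lemma emb_bar_type A : (val (emb_bar A) \in Sigma) = (val A \notin Sigma).
Proof. by rewrite CM_type_rho //; apply: valP. Qed.

(** Sigma b is again a CM type, because rho is central: [type_cochar b] takes the
values 0 and 1 on any pair of complex conjugate embeddings. So the common value
of the sums over such pairs is the total of the coefficients of the preimage. *)
Lemma L_mu_sub_GU (x : cochar Ec E) : L_mu Sigma x -> cochar_GU rho x.
Proof.
move=> [y <-]; apply/(cochar_GUP _ hrho hSigma).
have const (A A' : emb Ec E) : val A' = val A :* rho ->
    cochar_r y A + cochar_r y A' = \sum_B y B.
  move=> AA; rewrite !sum_ffunE -big_split; apply: eq_bigr => B _ /=.
  rewrite !ffunMzE -mulrzDl -/(type_cochar _) !type_cocharE.
  have bG : repr (val B) \in G by apply: repr_emb.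
  rewrite AA -rcosetM rhoC ?groupV // rcosetM CM_type_rho; last first.
    by apply: embeddings_mulr; rewrite ?groupV //; apply: valP.
  by case: (_ \in _); rewrite ?addr0 ?add0r intz.
by move=> A A' B B' _ _ /const -> /const ->.
Qed.

Lemma mem_embeddings (M : {subfield L}) a :
  a \in G -> 'Gal(Ec / M)%g :* a \in embeddings Ec M.
Proof. by move=> aG; apply/rcosetsP; exists a. Qed.

Definition coset_emb (M : {subfield L}) a (aG : a \in G) : emb Ec M :=
  Sub ('Gal(Ec / M)%g :* a) (mem_embeddings M aG).

Lemma cochar_r_coset_emb a (aG : a \in G) :
  cochar_r (cochar_basis (coset_emb (reflex_field E Sigma) aG)) = type_cochar a.
Proof. by apply: cochar_r_basis CM_type_sub _; apply: rcoset_refl. Qed.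

Definition flips_only (A : emb Ec E) (n : gal_of Ec) :=
  [/\ n \in G, val A :* n = val A :* rho
    & forall B, B \in Sigma -> B != val A -> B :* n = B].

Lemma type_cochar_flip A n : val A \in Sigma -> flips_only A n ->
  type_cochar n - type_cochar 1%g =
  cochar_basis (emb_bar A) - cochar_basis A.
Proof.
move=> AS [nG An Bn]; rewrite /type_cochar (bigD1 _ AS) /= [in X in _ - X](bigD1 _ AS) /=.
rewrite An rcoset1 opprD addrACA -sumrB big1 => [|B /andP[BS BA]]; last first.
  by rewrite (Bn B) // rcoset1 subrr.
by rewrite addr0; apply/ffunP => C; rewrite !ffunE.
Qed.

Variables (A0 : emb Ec E) (flip_ : emb Ec E -> gal_of Ec).
Hypothesis flip_G : forall A, flip_ A \in G.
Hypothesis flip_P : forall A, val A \in Sigma -> flips_only A (flip_ A).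

(** The preimage under X_*(r) of a cocharacter of GU_E, extended to all of
X_*(R_E) by computing the constant x A + x (A rho) at the embedding A0. *)
Definition cochar_section (x : {ffun emb Ec E -> int}) :
    {ffun emb Ec (reflex_field E Sigma) -> int} :=
  let e1 := cochar_basis (coset_emb (reflex_field E Sigma) (group1 _)) in
  e1 *~ (x A0 + x (emb_bar A0)) +
  \sum_(A | val A \in Sigma)
    (cochar_basis (coset_emb _ (flip_G A)) - e1) *~ x (emb_bar A).

Lemma cochar_section_zmod_morphism : zmod_morphism cochar_section.
Proof.
move=> x y; rewrite /cochar_section.
rewrite opprD addrACA -sumrB; congr (_ + _).
  by rewrite -mulrzBr !ffunE opprD addrACA.
by apply: eq_bigr => A _; rewrite -mulrzBr !ffunE.
Qed.

HB.instance Definition _ := GRing.isZmodMorphism.Build _ _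
  cochar_section cochar_section_zmod_morphism.

(** The image is c mu + sum_(A in Sigma) x (A rho) ([A rho] - [A]). Its
coordinate at C is c - x (C rho) = x C if C is in Sigma, and x C otherwise. *)
Lemma cochar_sectionK (x : cochar Ec E) : cochar_GU rho x ->
  cochar_r (cochar_section x) = x.
Proof.
move=> /(cochar_GUP _ hrho hSigma) xGU.
have x_bar A : x A + x (emb_bar A) = x A0 + x (emb_bar A0).
  have key B C : val B \in Sigma -> val C \in Sigma ->
      x B + x (emb_bar B) = x C + x (emb_bar C) by move=> *; apply: xGU.
  have bar B : x (emb_bar B) + x (emb_bar (emb_bar B)) = x B + x (emb_bar B).
    by rewrite emb_barK addrC.
  have typ B : exists2 C, val C \in Sigma & x B + x (emb_bar B) = x C + x (emb_bar C).
    have [BS|BS] := boolP (val B \in Sigma); first by exists B.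
    by exists (emb_bar B); rewrite ?emb_bar_type // bar.
  by have [B BS ->] := typ A; have [C CS ->] := typ A0; apply: key.
rewrite /cochar_section raddfD raddf_sum raddfMz /=.
under eq_bigr => A AS do rewrite raddfMz raddfB /= !cochar_r_coset_emb
  (type_cochar_flip AS (flip_P AS)).
rewrite cochar_r_coset_emb; apply/ffunP => C.
rewrite ffunE sum_ffunE ffunMzE type_cocharE invg1 rcoset1 -(x_bar C).
under eq_bigr => A _ do rewrite ffunMzE !ffunE.
have [CS|CS] := boolP (val C \in Sigma).
  rewrite (bigD1 C) //= eqxx big1 => [|A /andP[AS AC]]; last first.
    rewrite (eq_sym C A) (negPf AC).
    by case: eqP => [CA|]; rewrite ?mul0rz //; rewrite CA emb_bar_type AS in CS.
  case: eqP => [CA|_]; first by have := emb_bar_type C; rewrite -CA CS.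
  by rewrite addr0 sub0r mulNrz !intz addrK.
rewrite (bigD1 (emb_bar C)) ?emb_bar_type //= emb_barK eqxx mul0rz add0r.
rewrite big1 => [|A /andP[AS AC]]; last first.
  have -> : (C == emb_bar A) = false.
    by apply/eqP => CA; rewrite CA emb_barK eqxx in AC.
  by case: eqP => [CA|_]; rewrite ?mul0rz //; rewrite CA AS in CS.
case: eqP => [CA|_]; first by have := emb_bar_type C; rewrite -CA (negPf CS).
by rewrite subr0 addr0 intz.
Qed.

End Lattice.

(** * Lattices and kernel when the sign group is full *)

Lemma card_CM_type (L : splittingFieldType rat) (E Ec : {subfield L})
    (rho : gal_of Ec) (Sigma : {set {set gal_of Ec}}) :
  (E <= Ec)%VS -> galois 1 Ec -> CM_type E rho Sigma ->
  \dim E = (2 * #|Sigma|)%N.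
Proof.
move=> sEEc galEc [SE SD].
have rho_inj : injective (fun A : {set gal_of Ec} => A :* rho).
  exact: can_inj (rcosetK rho).
have -> : \dim E = #|'Gal(Ec / 1) : 'Gal(Ec / E)|%g.
  by rewrite index_gal ?sub1v // dimv1 divn1.
rewrite /indexg -[rcosets _ _]SE cardsU.
rewrite (eqP (_ : _ :&: _ == set0)) ?setI_eq0 //.
by rewrite cards0 subn0 card_imset // mul2n addnn.
Qed.

Theorem proposition4p6 (L : splittingFieldType rat)
  (iota : {rmorphism L -> algC}) (E F Ec Fc : {subfield L}) (g v : nat)
  (rho : gal_of Ec) (Sigma : {set {set gal_of Ec}})
  (hE : CM_field E) (hdim : \dim E = (2 * g)%N)
  (hF : max_totally_real_subfield E F)
  (hEc : galois_closure E Ec) (hFc : galois_closure F Fc)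
  (hrho : complex_conjugation iota rho)
  (hSigma : CM_type E rho Sigma)
  (hv : ('Gal(Ec / Fc) \isog [set: 'rV['Z_2]_v])%g)
  (hvg : v = g) :
  (forall x : cochar Ec E, L_mu Sigma x <-> cochar_GU rho x) /\
  zariski_connected (torus_kernel (@cochar_r L Ec E Sigma)).
Proof.
have [sEEc galEc _] := hEc; have [sFE Freal _] := hF; have [Eimag _] := hE.
have sFEc := subv_trans sFE sEEc.
have galF : galois F Ec by apply: galoisS galEc; rewrite sub1v.
have sHK : 'Gal(Ec / E)%g \subset 'Gal(Ec / F)%g by apply: galS.
have indexHK : #|'Gal(Ec / F) : 'Gal(Ec / E)|%g = 2%N.
  by rewrite index_gal ?sFE // (CM_quadratic iota hE hF).
have rhoKH a : a \in 'Gal(Ec / 1)%g ->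
    (rho ^ a)%g \in 'Gal(Ec / F)%g :\: 'Gal(Ec / E)%g.
  move=> _; rewrite inE (conj_rho_totally_real hrho a sFEc Freal) andbT.
  exact: (conj_rho_totally_imaginary hrho a sEEc Eimag).
have coreH := gcore_gal_closure hEc.
have rhoC := rho_central sHK indexHK rhoKH coreH.
have [/andP[sNG nNG] sNK] := gal_closure_normal sFE hEc hFc.
have cardN : #|'Gal(Ec / Fc)%g| = (2 ^ #|Sigma|)%N.
  rewrite (card_isog hv) cardsT card_mx card_ord mul1n hvg.
  have := card_CM_type sEEc galEc hSigma; rewrite hdim => /eqP.
  by rewrite eqn_pmul2l // => /eqP->.
have [SE _] := hSigma.
have flip_ex := single_flip sHK indexHK rhoKH coreH sNG sNK nNG SE cardN.
have /fin_all_exists[flip_ flip_spec] (A : emb Ec E) : exists n : gal_of Ec,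
    n \in 'Gal(Ec / 1)%g /\ (val A \in Sigma -> flips_only rho Sigma A n).
  have [AS|AS] := boolP (val A \in Sigma); last by exists 1%g; rewrite group1.
  have [n [nN An Bn]] := flip_ex _ AS; have nG := subsetP sNG n nN.
  by exists n.
have flip_G A : flip_ A \in 'Gal(Ec / 1)%g := proj1 (flip_spec A).
have flip_P A := proj2 (flip_spec A).
pose A0 : emb Ec E := coset_emb E (group1 _).
have sK := cochar_sectionK hrho hSigma A0 flip_G flip_P.
have subGU := L_mu_sub_GU hrho hSigma rhoC.
split=> [x|].
  split; first exact: subGU.
  by move/sK => sx; exists (cochar_section Sigma hrho A0 flip_G x).
apply: (torus_kernel_connected (s := cochar_section Sigma hrho A0 flip_G)) => y.
by apply/sK/subGU; exists y.
Qed.
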